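(* Let $K$ be a field of characteristic zero, let $n\ge 2$ and $1\le m\le n-1$ be integers with $\gcd(n,m)=1$, and let $\mathcal{P}(n,m)$ be the $m$th maximal parabolic subalgebra of $\mathrm{sl}(n)$ over $K$. Then the cyclic functional $F_{n,m}\in\mathcal{P}(n,m)^*$ is Frobenius, i.e. the skew bilinear form $B(x,y)=F_{n,m}([x,y])$ on $\mathcal{P}(n,m)$ is non-degenerate.
   Context: $\mathcal{P}(n,m)$ is the Lie algebra of all $n\times n$ matrices $X=(x_{ij})$ over $K$ of trace zero with $x_{ij}=0$ whenever both $i\ge m+1$ and $j\le m$. Let $e_{ij}$ denote the matrix with $1$ in place $(i,j)$ and zeros elsewhere, and let $e_{ij}^*$ be the linear functional on $n\times n$ matrices taking a matrix to its $(i,j)$ entry. For a set $S$ of pairs of indices, $F_S=\sum_{(i,j)\in S}e_{ij}^*$, restricted to the Lie algebra under consideration. Cyclic functional. Let $\gcd(n,m)=1$. Write the integers $1,\dots,n$ in the cyclic order $1,\,m+1,\,2m+1,\dots,(n-1)m+1$, entries being reduced modulo $n$ to representatives in $\{1,\dots,n\}$; call this cyclic sequence $C_1$. A directed graph $\gamma(n,m)$ with vertices $1,\dots,n$ is built in steps $k=1,2,3,\dots$ from cyclic sequences $C_k$ of distinct integers. At each step, divide $C_k$ into its strings, i.e. maximal runs of cyclically consecutive entries along which the integers increase in their natural order (reading $C_k$ in its cyclic order). - If $k$ is odd: for each pair $a<b$ of successive entries of a string ($b$ immediately following $a$), add an arrow $a\to b$ to the graph. Then let $C_{k+1}$ consist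 of the first entries of the strings, in the cyclic order induced from $C_k$. - If $k$ is even: for each pair $a<b$ of successive entries of a string ($b$ immediately following $a$), add an arrow $b\to a$ to the graph (from the larger to the smaller). Then let $C_{k+1}$ consist of the last entries of the strings, in the cyclic order induced from $C_k$. The process stops after the step at which $C_k$ consists of a single string. The set $S_{n,m}$ consists of all pairs $(i,j)$ for which there is an arrow $i\to j$ in $\gamma(n,m)$, and $F_{n,m}=F_{S_{n,m}}$ is the cyclic functional on $\mathcal{P}(n,m)$. (Example: for $n=7$, $m=3$ the cyclic order is $1,4,7,3,6,2,5$ and $S_{7,3}=\{(1,4),(4,7),(3,6),(2,5),(3,1),(2,3)\}$.) *)

(* Defs.v *)
(* Indices are numbered from 0, as in 'I_n: the
   integer a of {1, ..., n} is represented by a.-1. *)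
From HB Require Import structures.
From mathcomp Require Import all_boot all_order all_algebra.

Set Implicit Arguments.
Unset Strict Implicit.
Unset Printing Implicit Defensive.

Import GRing.Theory.
Local Open Scope ring_scope.

Section FrobeniusFunctional.
Variables (K : fieldType) (n : nat).
Implicit Types (X Y : 'M[K]_n) (g : {vspace 'M[K]_n}) (F : 'Hom('M[K]_n, K^o)).

Definition lie X Y : 'M[K]_n := X *m Y - Y *m X.

Fact lieC X Y : lie X Y = - lie Y X.
Proof. by rewrite /lie opprB. Qed.

Fact lie_linearr X : linear (lie X).
Proof.
move=> a Y Z; rewrite /lie mulmxDr mulmxDl -scalemxAr -scalemxAl scalerBr.
by rewrite opprD addrACA.
Qed.

(* Only the restriction of F to g matters when g is a Lie subalgebra. *)
Definition lie_form g F (x y : subvs_of g) : K := F (lie (vsval x) (vsval y)).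
Arguments lie_form : clear implicits.

Fact lie_formC g F (x y : subvs_of g) :
  lie_form g F x y = (-1) ^+ true * idfun (lie_form g F y x).
Proof. by rewrite /lie_form lieC linearN /= expr1 mulN1r. Qed.

Fact lie_form_linearr g F (x : subvs_of g) : scalar (lie_form g F x).
Proof.
by move=> a y z; rewrite /lie_form linearP (lie_linearr (vsval x)) linearP.
Qed.

Fact lie_form_bilinear g F :
  bilinear_for (GRing.Scale.Law.clone _ _ *%R _)
    (GRing.Scale.Law.clone _ _ (@idfun K \; *%R) _) (lie_form g F).
Proof.
split=> [y|x] a u v /=; last exact: lie_form_linearr.
by rewrite ![lie_form _ F _ y]lie_formC lie_form_linearr /= !mulrDr mulrCA.
Qed.

HB.instance Definition _ g F := bilinear_isBilinear.Build K
  (subvs_of g) (subvs_of g) K _ _ (lie_form g F) (lie_form_bilinear g F).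
HB.instance Definition _ g F :=
  isHermitianSesquilinear.Build K (subvs_of g) true idfun (lie_form g F)
    (@lie_formC g F).

Definition frobenius_functional g F :=
  nondegenerate (lie_form g F : {skew_symmetric (subvs_of g)}).

Fact frobenius_functionalP g F :
  reflect (forall X, X \in g -> (forall Y, Y \in g -> F (lie X Y) = 0) -> X = 0)
          (frobenius_functional g F).
Proof.
rewrite /frobenius_functional /nondegenerate -subv0.
apply: (iffP subvP) => [ndF X gX FX0 | ndF x].
  have /ndF: vsproj g X \in
      orthov (lie_form g F : {skew_symmetric (subvs_of g)}) fullv.
    by apply/mem_orthovP => y _; rewrite /= /lie_form vsprojK // FX0 ?subvsP.
  by rewrite memv0 => /eqP/(congr1 vsval); rewrite vsprojK.
move=> /mem_orthovP xF0; rewrite memv0 -(vsvalK x).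
rewrite (ndF (vsval x)) ?linear0 ?subvsP // => Y gY.
by have := xF0 (vsproj g Y) (memvf _); rewrite /= /lie_form vsprojK.
Qed.

Definition entry (i j : 'I_n) X : K^o := X i j.

Fact entry_linear i j : linear (entry i j).
Proof. by move=> a X Y; rewrite /entry !mxE. Qed.

HB.instance Definition _ i j :=
  GRing.isLinear.Build K 'M[K]_n K^o _ (entry i j) (entry_linear i j).

Definition entry_functional (S : {set 'I_n * 'I_n}) : 'Hom('M[K]_n, K^o) :=
  \sum_(p in S) linfun (entry p.1 p.2).

Fact entry_functionalE S X :
  entry_functional S X = \sum_(p in S) X p.1 p.2.
Proof. by rewrite sum_lfunE; apply: eq_bigr => p _; rewrite lfunE. Qed.

Definition parabolic (m : nat) : {vspace 'M[K]_n} :=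
  (lker (linfun (@mxtrace K n : 'M[K]_n -> K^o)) :&:
   \bigcap_(p : 'I_n * 'I_n | (m <= p.1)%N && (p.2 < m)%N)
     lker (linfun (entry p.1 p.2)))%VS.

Fact parabolicP m X :
  reflect
    (\tr X = 0 /\ forall i j : 'I_n, (m <= i)%N -> (j < m)%N -> X i j = 0)
    (X \in parabolic m).
Proof.
rewrite memv_cap memv_ker lfunE /= memvE.
apply: (iffP andP) => -[trX X0]; split; try exact/eqP.
  move=> i j lemi ltjm; move/subv_bigcapP/(_ (i, j)): X0.
  by rewrite /= lemi ltjm -memvE memv_ker lfunE => /(_ isT)/eqP.
apply/subv_bigcapP => -[i j] /= /andP[lemi ltjm].
by rewrite -memvE memv_ker lfunE /= /entry X0.
Qed.

Fact lie_parabolic m X Y :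
  X \in parabolic m -> Y \in parabolic m -> lie X Y \in parabolic m.
Proof.
move=> /parabolicP[_ X0] /parabolicP[_ Y0]; apply/parabolicP; split.
  by rewrite /lie linearB /= mxtrace_mulC subrr.
move=> i j lemi ltjm; rewrite !mxE !big1 ?subrr // => k _.
  by have [/(Y0 _ _ lemi)->|/X0->] := ltnP k m; rewrite ?mul0r ?mulr0.
by have [/(X0 _ _ lemi)->|/Y0->] := ltnP k m; rewrite ?mul0r ?mulr0.
Qed.

End FrobeniusFunctional.

Section CyclicFunctional.
Local Open Scope nat_scope.
Implicit Types (c s : seq nat) (k m n : nat).

Fixpoint increasing_runs s : seq (seq nat) :=
  if s is a :: s' then
    if increasing_runs s' is (b :: r) :: rs then
      if a < b then (a :: b :: r) :: rs else [:: a] :: (b :: r) :: rs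
    else [:: [:: a]]
  else [::].

(* A cyclic sequence is a list up to rotation. Its least entry is always the
   first entry of a string, so that, starting from there, no string wraps
   around. *)
Definition strings c : seq (seq nat) :=
  increasing_runs (rot (index (foldr minn (head 0 c) c) c) c).

Definition step_arrows k c : seq (nat * nat) :=
  let ascents := flatten [seq zip s (behead s) | s <- strings c] in
  if odd k then ascents else [seq (p.2, p.1) | p <- ascents].

Definition next_cycle k c : seq nat :=
  [seq (if odd k then head 0 s else last 0 s) | s <- strings c].

(* N bounds the number of steps; as the length of C_k decreases at each step
   that does not stop the process, the bound size c is never reached early
   (see graph_arrowsE). *)
Fixpoint arrows_upto N k c : seq (nat * nat) :=
  if N is N'.+1 then
    step_arrows k c ++
    if size (strings c) <= 1 then [::]
    else arrows_upto N' k.+1 (next_cycle k c)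
  else [::].

Definition graph_arrows k c := arrows_upto (size c) k c.

Definition cyclic_order n m : seq nat := [seq (k * m) %% n | k <- iota 0 n].

Definition cyclic_pairs n m : {set 'I_n * 'I_n} :=
  [set p | (val p.1, val p.2) \in graph_arrows 1 (cyclic_order n m)].

Definition cyclic_functional (K : fieldType) n m : 'Hom('M[K]_n, K^o) :=
  entry_functional K (cyclic_pairs n m).

Fact increasing_runs_neq0 s : [::] \notin increasing_runs s.
Proof.
elim: s => //= a s; case: (increasing_runs s) => [|[|b r] rs] //= IHs.
by case: ifP => _; rewrite !inE //= in IHs *.
Qed.

Fact flatten_increasing_runs s : flatten (increasing_runs s) = s.
Proof.
elim: s => //= a s; have := increasing_runs_neq0 s.
case: (increasing_runs s) => [_ <-|[//|b r] rs _ <-] //=.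
by case: ifP.
Qed.

Fact flatten_strings c :
  flatten (strings c) = rot (index (foldr minn (head 0 c) c) c) c.
Proof. exact: flatten_increasing_runs. Qed.

Fact increasing_runs_cons a s :
  exists r rs, increasing_runs (a :: s) = (a :: r) :: rs.
Proof.
rewrite /=; case: (increasing_runs s) => [|[|b r] rs]; try by do 2!eexists.
by case: ifP => _; do 2!eexists.
Qed.

Fact size_increasing_runs s : size (increasing_runs s) <= size s.
Proof.
elim: s => //= a s; case: (increasing_runs s) => [|[|b r] rs] //= IHs.
by case: ifP => _ //=; apply: ltnW.
Qed.

Fact foldr_minn_le c x0 a : a \in c -> foldr minn x0 c <= a.
Proof.
elim: c => //= b c IHc; rewrite inE geq_min.
by case/orP=> [/eqP->|/IHc->]; rewrite ?leqnn ?orbT.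
Qed.

Fact foldr_minn_in c x0 : foldr minn x0 c \in x0 :: c.
Proof.
elim: c => [|b c IHc] /=; first exact: mem_head.
rewrite /minn; case: ifP => _; first by rewrite !inE eqxx orbT.
by rewrite inE in_cons orbCA -in_cons IHc orbT.
Qed.

Fact size_strings c : uniq c -> 1 < size c -> size (strings c) < size c.
Proof.
case Dc: {1 2}c => // [x0 c'] Uc gt1; rewrite /strings.
set x := foldr _ _ _; have cx: x \in c.
  have c0: head 0 c \in c by rewrite Dc mem_head.
  by have := foldr_minn_in c (head 0 c); rewrite inE -/x => /orP[/eqP->|].
rewrite -[ltnRHS](size_rot (index x c)).
have Ur: uniq (rot (index x c) c) by rewrite rot_uniq Dc.
have mr a : a \in rot (index x c) c -> x <= a.
  by rewrite mem_rot; apply: foldr_minn_le.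
have szr : 1 < size (rot (index x c) c) by rewrite size_rot Dc.
move: Ur mr szr; rewrite rot_index //.
case: (_ ++ _) => // b r /andP[]; rewrite inE negb_or => /andP[neq_xb _] _ mr _.
have ltxb: x < b by rewrite ltn_neqAle neq_xb mr // !inE eqxx orbT.
have runs_cons s : forall r1 rs, increasing_runs s = (b :: r1) :: rs ->
    increasing_runs (x :: s) = (x :: b :: r1) :: rs.
  by move=> r1 rs /= ->; rewrite ltxb.
have [r1 [rs Drs]] := increasing_runs_cons b r.
by have := size_increasing_runs (b :: r); rewrite (runs_cons _ _ _ Drs) Drs.
Qed.

Fact uniq_next_cycle k c : uniq c -> uniq (next_cycle k c).
Proof.
move=> Uc; have: uniq (flatten (strings c)).
  by rewrite flatten_strings rot_uniq.
apply: subseq_uniq; rewrite /next_cycle /strings.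
have := increasing_runs_neq0 (rot (index (foldr minn (head 0 c) c) c) c).
elim: increasing_runs => // -[|a r] rs IHrs; rewrite inE ?eqxx //.
move/IHrs=> {IHrs} sub.
apply: (@cat_subseq _ [:: _] _ (a :: r)) => //.
by rewrite sub1seq; case: (odd k); [exact: mem_head | exact: mem_last].
Qed.

Fact graph_arrowsE k c : uniq c ->
  graph_arrows k c = step_arrows k c ++
    if size (strings c) <= 1 then [::] else graph_arrows k.+1 (next_cycle k c).
Proof.
have ext N j d : uniq d -> size d <= N -> arrows_upto N j d = graph_arrows j d.
  rewrite /graph_arrows; elim: {N}_.+1 {-2}N (ltnSn N) j d => // N IHN M.
  rewrite ltnS => leMN j d Ud.
  case: M leMN => [|M] leMN; first by rewrite leqn0 => /eqP->.
  case Dd: (size d) => [|D].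
    by move/size0nil: Dd => ->; rewrite /= /step_arrows /=; case: odd.
  rewrite ltnS => leDM /=; case: ifP => // gt1; congr (_ ++ _).
  have ltS: size (next_cycle j d) <= D.
    rewrite size_map -ltnS -Dd size_strings // Dd ltnS lt0n.
    apply: contraFneq gt1 => D0; rewrite (leq_trans (size_increasing_runs _)) //.
    by rewrite size_rot Dd D0.
  rewrite (IHN M) ?uniq_next_cycle ?(leq_trans ltS) //.
  by rewrite (IHN D) ?uniq_next_cycle // (leq_ltn_trans leDM).
move=> Uc; rewrite -(ext (size c).+1) //=; case: ifP => // _.
rewrite ext ?uniq_next_cycle // size_map.
by rewrite (leq_trans (size_increasing_runs _)) ?size_rot.
Qed.

Example graph_arrows_7_3 :
  graph_arrows 1 (cyclic_order 7 3)
  = [seq (p.1.-1, p.2.-1) |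
      p <- [:: (1, 4); (4, 7); (3, 6); (2, 5); (3, 1); (2, 3)]].
Proof. by []. Qed.

End CyclicFunctional.

(* Main.v *)
Require Import Defs.
From mathcomp Require Import all_boot all_order all_algebra.
From mathcomp Require Import zify.

Set Implicit Arguments.
Unset Strict Implicit.
Unset Printing Implicit Defensive.

Import GRing.Theory.

(** Let G be the graph of the cyclic functional F, and let A be the matrix with
a 1 in place (j, i) for each arrow i -> j, so that F X = tr (A X).  An element
X of the parabolic subalgebra is in the radical of F ([x, y]) exactly when
[A, X] is orthogonal to the subalgebra under the trace form, that is, when
[A, X] is a multiple of the identity up to an element of the upper right block
(rows < m <= columns).  The multiple is 0, as [A, X] has trace 0 and n is
invertible, so everything comes down to showing that a block triangular X which
commutes with A modulo the upper right block is a scalar matrix: its trace n c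
then vanishes, hence so does X.

This rigidity is proved by induction along a variant of the Euclidean
algorithm, because the graph is self-similar ([euclidean_graph]).  The first
step contributes the arrows a -> a + m.  Its descents lead exactly into the
vertices 0, ..., m - 1, so these make up C_2, on which the return map of the
rotation by m is x |-> x - n mod m.  So, with m' = m - n %% m, C_2 is again the
cyclic order of m and m'; even steps select the last entries of the strings and
orient the arrows downwards, which amounts to exchanging x and m - 1 - x.  Thus
G consists of the arrows a -> a + m and of a mirror image of the graph of
(m, m') on {0, ..., m - 1} ([euclidean_graph_arrows]).

For such a graph, the equations for [A, X] in the rows i >= m say that X is
constant along the diagonals (i, j), (i + m, j + m), ..., and zero if the
column index leaves {0, ..., n - 1} before the row index does
([diagonal_step], [diagonal_exit]).  It follows that the mirror image of the
upper left m x m block of X is block triangular for (m, m'), and it commutes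
with the matrix of the smaller graph modulo its upper right block: on all other
entries, the contribution of the arrows a -> a + m vanishes.  By induction the
m x m block is scalar; then its commutator vanishes, which kills the entries
(i, j + m) with i, j < m, and the diagonals propagate the result to all of X
([euclidean_graph_rigid]). *)

(** * Strings of a cyclic sequence *)

Local Open Scope nat_scope.

Definition ascents (s : seq nat) : seq (nat * nat) :=
  [seq p <- zip s (behead s) | p.1 < p.2].
Definition descents (s : seq nat) : seq (nat * nat) :=
  [seq p <- zip s (behead s) | ~~ (p.1 < p.2)].

Lemma increasing_runs_cons2 a b s :
  exists r rs, increasing_runs (b :: s) = (b :: r) :: rs
    /\ increasing_runs [:: a, b & s]
       = if a < b then [:: a, b & r] :: rs else [:: a] :: (b :: r) :: rs.
Proof.
have [r [rs Drs]] := increasing_runs_cons b s; exists r, rs; split=> //.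
by move: Drs; rewrite [in RHS]/= /= => ->.
Qed.

Lemma increasing_runs_ascents s :
  flatten [seq zip r (behead r) | r <- increasing_runs s] = ascents s.
Proof.
rewrite /ascents; elim: s => // a [//|b s].
have [r [rs [Drs ->]]] := increasing_runs_cons2 a b s; rewrite Drs => IHs.
by case: ifP => ltab /=; rewrite ltab -IHs.
Qed.

Lemma head_increasing_runs a s :
  [seq head 0 r | r <- increasing_runs (a :: s)]
  = a :: [seq p.2 | p <- descents (a :: s)].
Proof.
rewrite /descents; elim: s a => // b s IHs a.
have [r [rs [Drs ->]]] := increasing_runs_cons2 a b s; have := IHs b.
by rewrite Drs; case: ifP => ltab /=; rewrite ltab /= => -[->].
Qed.

Lemma last_increasing_runs a s :
  [seq last 0 r | r <- increasing_runs (a :: s)]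
  = rcons [seq p.1 | p <- descents (a :: s)] (last a s).
Proof.
rewrite /descents; elim: s a => // b s IHs a.
have [r [rs [Drs ->]]] := increasing_runs_cons2 a b s; have := IHs b.
by rewrite Drs; case: ifP => ltab /=; rewrite ltab /= => ->.
Qed.

Lemma increasing_runs_shift lo s :
  increasing_runs [seq lo + x | x <- s]
  = [seq [seq lo + x | x <- r] | r <- increasing_runs s].
Proof.
elim: s => //= a s ->; case: (increasing_runs s) => [|[|b r] rs] //=.
by rewrite ltn_add2l; case: ifP.
Qed.

(** The strings do not depend on where a cyclic sequence is cut, so that the
[C_k] need only be known up to rotation. *)
Lemma strings_rot i x0 s :
  uniq (x0 :: s) -> {in s, forall y, x0 <= y} ->
  strings (rot i (x0 :: s)) = increasing_runs (x0 :: s).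
Proof.
move=> Us les; rewrite /strings.
set c := rot i _; set x := foldr _ _ _.
have memc y : (y \in c) = (y \in x0 :: s) by rewrite mem_rot.
have ->: x = x0.
  have: x \in c.
    have c0: head 0 c \in c.
      have: x0 \in c by rewrite memc mem_head.
      by case: (c) => // *; apply: mem_head.
    by have := foldr_minn_in c (head 0 c); rewrite inE -/x => /orP[/eqP->|].
  rewrite memc inE => /orP[/eqP//|/les lex]; apply/eqP; rewrite eqn_leq lex andbT.
  by apply: foldr_minn_le; rewrite memc mem_head.
congr increasing_runs; rewrite /c; case: i {c x memc} => [|i].
  by rewrite rot0 /= eqxx rot0.
rewrite {2}/rot index_cat [drop _ _]/= [take _ _]/=.
have /negPf->: x0 \notin drop i s.
  by move: Us => /= /andP[+ _]; apply: contra; apply: mem_drop.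
rewrite /= eqxx addn0 /rot /= drop_size_cat // take_size_cat //.
by rewrite cat_cons cat_take_drop.
Qed.

(** * The rotation by m and its return map *)

Section CyclicOrder.
Variables n m : nat.

Definition turn x := (x + m) %% n.

Lemma cyclic_orderE : cyclic_order n m = traject turn 0 n.
Proof.
apply: (@eq_from_nth _ 0) => [|k].
  by rewrite size_map size_iota size_traject.
rewrite size_map size_iota => ltk.
rewrite (nth_map 0) ?size_iota // nth_iota // add0n nth_traject //.
elim: k {ltk} => [|k /= <-]; first by rewrite mod0n.
by rewrite /turn modnDml mulSn addnC.
Qed.

Hypotheses (m_gt0 : 0 < m) (ltmn : m < n) (co_nm : coprime n m).

Lemma cyclic_order_uniq : uniq (cyclic_order n m).
Proof.
rewrite map_inj_in_uniq ?iota_uniq // => j k; rewrite !mem_iota /= !add0n.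
wlog lejk: j k / j <= k => [IH|ltj ltk /eqP].
  by case: (leqP j k) => [/IH//|/ltnW/IH IHkj] ltj ltk /esym/IHkj->.
rewrite eq_sym eqn_mod_dvd ?leq_mul // -mulnBl Gauss_dvdl // => dv.
apply/eqP; rewrite eqn_leq lejk /= -subn_eq0.
by apply: contraLR dv => ne; rewrite gtnNdvd // ?lt0n //; lia.
Qed.

Lemma mem_cyclic_order x : (x \in cyclic_order n m) = (x < n).
Proof.
have sub: {subset cyclic_order n m <= iota 0 n}.
  by move=> _ /mapP[k _ ->]; rewrite mem_iota /= add0n ltn_mod; lia.
have [|_ ->] := uniq_min_size cyclic_order_uniq sub; last by rewrite mem_iota.
by rewrite !size_map.
Qed.

Lemma turnE x : x < n -> turn x = if x + m < n then x + m else x + m - n.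
Proof.
move=> ltx; rewrite /turn; case: ltnP => h; first by rewrite modn_small.
by rewrite -{1}(subnK h) modnDr modn_small //; lia.
Qed.

Lemma cyclic_order_cons :
  cyclic_order n m = 0 :: [seq turn x | x <- traject turn 0 n.-1].
Proof.
rewrite cyclic_orderE -{1}(ltn_predK ltmn) /=; congr (_ :: _).
by elim: n.-1 0 => //= k IHk x; rewrite IHk.
Qed.

(** The rotation takes the last entry of the cyclic order back to 0. *)
Lemma turn_last : iter n.-1 turn 0 = n - m.
Proof.
have: turn (iter n.-1 turn 0) = 0.
  have it k : iter k turn 0 = (k * m) %% n.
    by elim: k => [|k /= ->]; rewrite ?mod0n // /turn modnDml mulSn addnC.
  by rewrite -iterS it prednK ?modnMr //; lia.
have ltl: iter n.-1 turn 0 < n.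
  by case: n.-1 => [|k] /=; [lia | rewrite /turn ltn_mod; lia].
by rewrite turnE //; case: ifP; lia.
Qed.

Lemma zip_cyclic_order :
  zip (cyclic_order n m) (behead (cyclic_order n m))
  = [seq (x, turn x) | x <- traject turn 0 n.-1].
Proof.
rewrite cyclic_orderE -{1 2}(ltn_predK ltmn).
by elim: n.-1 0 => //= k IHk x; rewrite -IHk.
Qed.

Lemma ltn_traject x : x \in traject turn 0 n.-1 -> x < n.
Proof.
rewrite -mem_cyclic_order cyclic_orderE -{2}(ltn_predK ltmn) trajectSr.
by rewrite mem_rcons inE orbC => ->.
Qed.

(** Cutting the cyclic order before 0 loses no ascent: the last entry is n - m,
which descends to 0. *)
Lemma ascents_cyclic_order a b :
  ((a, b) \in ascents (cyclic_order n m)) = (b < n) && (b == a + m).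
Proof.
rewrite mem_filter zip_cyclic_order /=; apply/andP/andP => [[ltab]|[ltb /eqP Db]].
  case/mapP=> x /ltn_traject ltx [Da]; rewrite turnE // -Da => Db; move: ltab.
  by rewrite Db; case: ifP; lia.
split; first lia; apply/mapP; exists a; last by rewrite turnE -?Db ?ltb //; lia.
have: a \in cyclic_order n m by rewrite mem_cyclic_order; lia.
rewrite cyclic_orderE -{1}(ltn_predK ltmn) trajectSr mem_rcons inE turn_last.
by case/orP=> // /eqP; lia.
Qed.

End CyclicOrder.

(** For x < m, the first return of x to {0, ..., m - 1} under the rotation by m
modulo n is x - n, that is, x + comodulus n m, modulo m. *)
Definition comodulus n m := m - n %% m.

Section NextCyclicOrder.
Variables n m : nat.
Hypotheses (m_gt0 : 0 < m) (ltmn : m < n) (co_nm : coprime n m).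

(** Restricting the rotation to {0, ..., m - 1} gives its return map there.
Following the orbit from any x, [first_small x] is the first entry below m. *)
Lemma filter_cyclic_order :
  [seq x <- cyclic_order n m | x < m] = cyclic_order m (comodulus n m).
Proof.
have sz: size [seq x <- cyclic_order n m | x < m] = m.
  have /perm_size->: perm_eq [seq x <- cyclic_order n m | x < m] (iota 0 m).
    apply: uniq_perm; rewrite ?filter_uniq ?iota_uniq ?cyclic_order_uniq // => x.
    by rewrite mem_filter mem_cyclic_order // mem_iota; lia.
  by rewrite size_iota.
pose g := turn m (comodulus n m).
pose first_small x := if x < m then x else g (x %% m).
have wrap x : n <= x + m -> x < n -> g (x %% m) = x + m - n.
  move=> lenx ltx; rewrite /g /turn /comodulus modnDml.
  apply/eqP; rewrite -[X in _ == X](@modn_small _ m); last lia.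
  rewrite -(eqn_modDr n) subnK // -addnA.
  have ->: m - n %% m + n = (n %/ m).+1 * m.
    by move: (ltn_pmod n m_gt0) (divn_eq n m); lia.
  by rewrite addnC modnMDl modnDr.
have walk k x : x < n ->
    [seq y <- traject (turn n m) x k | y < m]
    = traject g (first_small x) (size [seq y <- traject (turn n m) x k | y < m]).
  elim: k x => // k IHk x ltx /=.
  have ltt: turn n m x < n by rewrite ltn_mod; lia.
  have first_turn: first_small (turn n m x) = g (x %% m).
    rewrite /first_small turnE //; case: (ltnP (x + m)) => h.
      by rewrite ltnNge leq_addl /= modnDr.
    by rewrite ifT ?wrap //; lia.
  case: ifP => ltxm; rewrite IHk // first_turn /first_small ltxm //=.
    by rewrite size_traject modn_small.
  by rewrite size_traject.
have := walk n 0; rewrite -cyclic_orderE sz /first_small m_gt0 => -> //; last lia.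
by rewrite (cyclic_orderE m).
Qed.

(** A string starts after a descent x > x + m - n, hence with an entry below m;
conversely only descents lead to such entries. *)
Lemma head_strings_cyclic_order :
  [seq head 0 r | r <- increasing_runs (cyclic_order n m)]
  = cyclic_order m (comodulus n m).
Proof.
rewrite -filter_cyclic_order.
have Dc := cyclic_order_cons ltmn.
rewrite {1}Dc head_increasing_runs -Dc /descents zip_cyclic_order //.
rewrite Dc /= m_gt0 !filter_map -!map_comp; congr (_ :: _).
rewrite (eq_in_filter (a2 := preim (turn n m) (fun x => x < m))) //.
move=> x /ltn_traject ltx /=; rewrite turnE ?ltx //.
by case: ifP; lia.
Qed.

(** The last entry of a string exceeds the first entry of the next string by
n - m; the shift to the next string is the rotation by one place. *)
Lemma last_strings_cyclic_order :
  [seq last 0 r | r <- increasing_runs (cyclic_order n m)]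
  = [seq n - m + x | x <- rot 1 (cyclic_order m (comodulus n m))].
Proof.
rewrite -head_strings_cyclic_order.
have Dc := cyclic_order_cons ltmn.
rewrite {1 2}Dc head_increasing_runs last_increasing_runs -Dc.
rewrite rot1_cons map_rcons addn0; congr rcons; last first.
  rewrite -[LHS]/(last 0 (0 :: _)) -Dc cyclic_orderE -{2}(ltn_predK ltmn).
  by rewrite trajectSr last_rcons turn_last.
rewrite -map_comp; apply/eq_in_map => -[x y].
rewrite mem_filter zip_cyclic_order // => /andP[/= geyx /mapP[z]].
by move=> /ltn_traject ltz [Dx]; rewrite -Dx turnE ?Dx ?ltz //; case: ifP; lia.
Qed.

End NextCyclicOrder.

(** * Self-similarity of the graph *)

Lemma ascents_shift lo s :
  ascents [seq lo + x | x <- s] = [seq (lo + p.1, lo + p.2) | p <- ascents s].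
Proof.
rewrite /ascents; elim: s => // a [//|b s] IHs.
rewrite /= ltn_add2l -[zip _ _]/(zip _ (behead [seq lo + x | x <- b :: s])).
by rewrite IHs; case: ifP.
Qed.

(** The graph of (n, m) is made of the arrows a -> a + m and of the graph of
(m, comodulus n m) transported to {0, ..., m - 1} by a |-> m - 1 - a. *)
Inductive euclidean_graph : nat -> nat -> rel nat -> Prop :=
| EuclideanGraph1 m (G : rel nat) : euclidean_graph 1 m G
| EuclideanGraphS n m (G G' : rel nat) :
    0 < m < n -> euclidean_graph m (comodulus n m) G' ->
    (forall a b, a < n -> b < n ->
       G a b = (b == a + m) || [&& a < m, b < m & G' (m.-1 - a) (m.-1 - b)]) ->
  euclidean_graph n m G.

(** The vertices of [C_k] are an interval of length n starting at lo.  It is read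
upwards at odd steps and downwards at even ones, so that the arrows of step k
are always those from the place of a to the place of a + m. *)
Definition place k lo n a := lo + (if odd k then a else n.-1 - a).

Lemma comodulus_bounds n m : 1 < m -> coprime n m -> 0 < comodulus n m < m.
Proof.
move=> gtm1 co_nm; rewrite subn_gt0 ltn_mod ltn_subrL (ltnW gtm1) andbT lt0n /=.
apply: contraL co_nm => /eqP mod0.
by rewrite -coprime_modl mod0 /coprime gcd0n; lia.
Qed.

Lemma coprime_comodulus n m : 0 < m -> coprime n m -> coprime m (comodulus n m).
Proof.
move=> m_gt0; rewrite -coprime_modl /coprime /comodulus.
have ler := ltnW (ltn_pmod n m_gt0).
set r := n %% m in ler *.
have: gcdn r (r + (m - r)) = gcdn (m - r) (m - r + r).
  by rewrite !gcdnDl gcdnC.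
by rewrite subnKC // subnK // [gcdn m _]gcdnC => ->.
Qed.

(** The self-similarity holds at every step: [C_k] is always a translated cyclic
order.  At odd steps [C_(k+1)] occupies the bottom m vertices of the interval,
at even steps the top m ones; either way these are the places of 0, ..., m - 1.
The range of the arrows is part of the induction because it shows that the later
steps only add arrows between these places. *)
Lemma euclidean_graph_arrows n m k lo i :
  0 < m < n -> coprime n m ->
  let arrows := graph_arrows k (rot i [seq lo + x | x <- cyclic_order n m]) in
  {in arrows, forall p, (lo <= p.1 < lo + n) && (lo <= p.2 < lo + n)} /\
  euclidean_graph n m (fun a b => (place k lo n a, place k lo n b) \in arrows).
Proof.
elim/ltn_ind: n m k lo i => n IHn m k lo i /andP[m_gt0 ltmn] co_nm.
set c := rot i _.
have Uc: uniq c.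
  by rewrite rot_uniq map_inj_uniq ?cyclic_order_uniq //; apply: addnI.
have Dstr: strings c = increasing_runs [seq lo + x | x <- cyclic_order n m].
  rewrite /c cyclic_order_cons //; apply: strings_rot => [|_ /mapP[x _ ->]].
    rewrite -[uniq _]/(uniq (map (addn lo) (_ :: _))) -cyclic_order_cons //.
    by rewrite -(rot_uniq i).
  by rewrite addn0 leq_addr.
have step_sub: {in step_arrows k c,
    forall p, (lo <= p.1 < lo + n) && (lo <= p.2 < lo + n)}.
  have sub a b : (a, b) \in ascents (cyclic_order n m) ->
      (lo <= lo + a < lo + n) && (lo <= lo + b < lo + n).
    by rewrite ascents_cyclic_order //; lia.
  rewrite /step_arrows Dstr increasing_runs_ascents ascents_shift.
  case: (odd k) => p.
    by case/mapP=> -[a b] /sub hab ->.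
  by case/mapP=> q /mapP[[a b] /sub hab ->] ->; rewrite andbC.
have step_place a b : a < n -> b < n ->
    ((place k lo n a, place k lo n b) \in step_arrows k c) = (b == a + m).
  move=> lta ltb; rewrite /step_arrows Dstr increasing_runs_ascents /place.
  rewrite ascents_shift.
  have shift_inj: injective (fun p : nat * nat => (lo + p.1, lo + p.2)).
    by move=> [x y] [z t] [] /addnI -> /addnI ->.
  case: (odd k).
    by rewrite (mem_map shift_inj (_ : _) (a, b)) ascents_cyclic_order ?ltb.
  have swap_inj: injective (fun p : nat * nat => (p.2, p.1)).
    by move=> [x y] [z t] [-> ->].
  rewrite (mem_map swap_inj _ (_, _)) (mem_map shift_inj _ (_, _)).
  by rewrite ascents_cyclic_order //; lia.
have Dnext: exists lo' i',
    [/\ Defs.next_cycle k c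
        = rot i' [seq lo' + x | x <- cyclic_order m (comodulus n m)],
        lo <= lo' /\ lo' + m <= lo + n,
      forall a, a < n -> lo' <= place k lo n a < lo' + m -> a < m
      & forall a, a < m -> place k.+1 lo' m (m.-1 - a) = place k lo n a].
  rewrite /Defs.next_cycle Dstr increasing_runs_shift /place -map_comp /=.
  case: (odd k) => /=.
    exists lo, 0; split; [|by lia|by move=> a; lia|by move=> a; lia].
    rewrite rot0 -head_strings_cyclic_order // -map_comp; apply/eq_in_map => -[|//].
    by rewrite (negPf (increasing_runs_neq0 _)).
  exists (lo + (n - m)), 1; split; [|by lia|by move=> a; lia|by move=> a; lia].
  rewrite -map_rot (eq_map (fun x => esym (addnA lo _ x))).
  rewrite (map_comp (addn lo) (addn _)) -last_strings_cyclic_order //.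
  rewrite -map_comp; apply/eq_in_map => -[|x r _ /=].
    by rewrite (negPf (increasing_runs_neq0 _)).
  by rewrite last_map.
have Dsz: size (strings c) = m.
  by rewrite Dstr increasing_runs_shift size_map -(size_map (head 0))
     head_strings_cyclic_order // size_map size_iota.
rewrite graph_arrowsE // Dsz.
have [lem1|gtm1] := leqP m 1.
  have Dm: m = 1 by lia.
  rewrite cats0; split=> //; apply: (@EuclideanGraphS n m _ (fun _ _ => false)).
  - by rewrite m_gt0.
  - by rewrite Dm; apply: EuclideanGraph1.
  by move=> a b lta ltb; rewrite step_place // !andbF orbF.
have [lo' [i' [-> [lelo' lelom] inside placeE]]] := Dnext.
have co' := coprime_comodulus m_gt0 co_nm.
have bd' := comodulus_bounds gtm1 co_nm.
have [sub' eg'] := IHn m ltmn _ k.+1 lo' i' bd' co'.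
set arrows' := graph_arrows _ _ in sub' eg' *.
split=> [p|].
  by rewrite mem_cat => /orP[/step_sub//|/sub']; lia.
apply: EuclideanGraphS eg' _; first by rewrite m_gt0.
move=> a b lta ltb; rewrite mem_cat step_place //; congr (_ || _).
apply/idP/and3P => [ab' | [ltam ltbm]]; last by rewrite !placeE.
have /andP[/= a' b'] := sub' _ ab'; have ltam := inside a lta a'.
by have ltbm := inside b ltb b'; rewrite !placeE.
Qed.

(** * Rigidity of the commutation equations *)

Section Rigidity.
Local Open Scope ring_scope.
Variable V : zmodType.
Implicit Types (X : nat -> nat -> V) (F : nat -> V).

(** X stands for the n x n matrix of its values below n; a function on natural
numbers restricts to the smaller sizes of the induction without casts. *)
Definition block_triangular n m X :=
  forall i j, (i < n)%N -> (j < n)%N -> (m <= i)%N -> (j < m)%N -> X i j = 0.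

(** The entries of A X and X A, for A the transposed incidence matrix of G,
agree outside the upper right block. *)
Definition block_commutes n m (G : rel nat) X :=
  forall i j, (i < n)%N -> (j < n)%N -> ~~ (i < m <= j)%N ->
  \sum_(k < n | G k i) X k j = \sum_(k < n | G j k) X i k.

Lemma big_ord_pred1 n F b (P : pred nat) :
  (forall k, (k < n)%N -> P k = (k == b)) ->
  \sum_(k < n | P k) F k = if (b < n)%N then F b else 0.
Proof.
move=> PE; case: ifP => ltb.
  by rewrite (big_pred1 (Ordinal ltb)) // => k; rewrite PE.
rewrite big_pred0 // => k; rewrite PE //.
by apply/eqP => kb; rewrite -kb ltn_ord in ltb.
Qed.

Section Step.
Variables (n m : nat) (G G' : rel nat) (X : nat -> nat -> V).
Hypothesis (m_gt0 : (0 < m)%N) (ltmn : (m < n)%N).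
Hypothesis GE : forall a b, (a < n)%N -> (b < n)%N ->
  G a b = (b == a + m)%N || [&& a < m, b < m & G' (m.-1 - a) (m.-1 - b)]%N.
Hypothesis (X0 : block_triangular n m X) (XC : block_commutes n m G X).

Let mirror_sum (P : pred nat) F :
  \sum_(k < m | P (m.-1 - k)%N) F k = \sum_(k < m | P k) F (m.-1 - k)%N.
Proof.
rewrite (reindex_inj rev_ord_inj) /=; apply: eq_big => [k|k _].
  by congr P; have := ltn_ord k; lia.
by congr F; have := ltn_ord k; lia.
Qed.

Let sum_in i F : (i < m)%N ->
  \sum_(k < n | G k i) F k = \sum_(k < m | G' k (m.-1 - i)%N) F (m.-1 - k)%N.
Proof.
move=> ltim; rewrite -(mirror_sum (fun k => G' k (m.-1 - i)%N)).
have lemn := ltnW ltmn.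
rewrite (big_ord_widen_cond n (fun k => G' (m.-1 - k) (m.-1 - i))%N F lemn).
by apply: eq_bigl => k; rewrite GE ?ltim //; lia.
Qed.

Let sum_out j F : (j < m)%N ->
  \sum_(k < n | G j k) F k
  = \sum_(k < m | G' (m.-1 - j)%N k) F (m.-1 - k)%N
    + (if (j + m < n)%N then F (j + m)%N else 0).
Proof.
move=> ltjm; rewrite -(mirror_sum (fun k => G' (m.-1 - j)%N k)).
have lemn := ltnW ltmn.
rewrite (big_ord_widen_cond n (fun k => G' (m.-1 - j) (m.-1 - k))%N F lemn).
rewrite (bigID (fun k : 'I_n => (k < m)%N)) /=; congr (_ + _).
  by apply: eq_bigl => k; rewrite GE ?ltjm //; lia.
apply: (@big_ord_pred1 n F _ (fun k => G j k && ~~ (k < m)%N)) => k ltk.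
by rewrite GE //; lia.
Qed.

(** This is the equation in the place (i + m, j).  The only arrow into i + m comes
from i; the arrows from j into {0, ..., m - 1} meet the zero block of X, which
leaves j -> j + m. *)
Lemma diagonal_step i j : (i + m < n)%N -> (j < n)%N ->
  X i j = if (j + m < n)%N then X (i + m)%N (j + m)%N else 0.
Proof.
move=> lti ltj; have := XC lti ltj; rewrite ltnNge leq_addl /= => /(_ isT).
rewrite (@big_ord_pred1 n (X^~ j) i (fun k => G k (i + m)%N)); last first.
  by move=> k ltk; rewrite GE //; lia.
rewrite (leq_ltn_trans (leq_addr m i) lti) => ->.
rewrite (bigID (fun k : 'I_n => (k < m)%N)) /= big1 => [|k /andP[_ ltk]]; last first.
  by rewrite X0 ?leq_addl.
rewrite add0r.
apply: (@big_ord_pred1 n _ _ (fun k => G j k && ~~ (k < m)%N)) => k ltk.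
by rewrite GE //; lia.
Qed.

Lemma diagonal_exit t i j :
  (i + t * m < n)%N -> (j < n)%N -> (n <= j + t * m)%N -> X i j = 0.
Proof.
elim: t i j => [|t IHt] i j; first lia.
rewrite mulSn => lti ltj len; rewrite diagonal_step ?ltj //; last lia.
by case: ifP => // ltjm; apply: IHt; lia.
Qed.

Let q := (n %/ m)%N.
Let r := (n %% m)%N.
Let n_eq : n = (q.-1 * m + m + r)%N.
Proof.
rewrite {1}(divn_eq n m) -/q -/r; congr (_ + _)%N.
have: (0 < q)%N by rewrite divn_gt0 // ltnW.
by case: (q) => // q' _; rewrite mulSn addnC.
Qed.
Let ltrm : (r < m)%N. Proof. exact: ltn_pmod. Qed.

Definition mirror i j := X (m.-1 - i)%N (m.-1 - j)%N.

(** For a < r <= b < m, the last entry of the diagonal of (a, b) is in a row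
a + q m and b + q m >= n, where q = n %/ m and r = n %% m. *)
Lemma mirror_triangular : block_triangular m (comodulus n m) mirror.
Proof.
move=> i j lti ltj; rewrite /comodulus -/r => lei ltjr.
by apply: (@diagonal_exit q.-1.+1); rewrite ?mulSn; lia.
Qed.

(** The equation of X in the place (m - 1 - i, j'), where j' = m - 1 - j, is that
of the mirror image in (i, j), but for the term X (m - 1 - i) (j' + m) of the
arrow j' -> j' + m.  Its diagonal leaves through the columns, except in the one
block that the smaller problem ignores. *)
Lemma mirror_commutes : block_commutes m (comodulus n m) G' mirror.
Proof.
move=> i j lti ltj; rewrite /comodulus -/r => nij.
have lti' : (m.-1 - i < m)%N by lia.
have ltj' : (m.-1 - j < m)%N by lia.
have invol a : (a < m)%N -> (m.-1 - (m.-1 - a))%N = a by lia.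
have nij' : ~~ (m.-1 - i < m <= m.-1 - j)%N by lia.
have := XC (ltn_trans lti' ltmn) (ltn_trans ltj' ltmn) nij'.
rewrite (sum_in (X^~ (m.-1 - j)%N)) // (sum_out (X (m.-1 - i)%N)) //.
rewrite !invol // /mirror => ->.
case: ifP => [ltjm|_]; last by rewrite addr0.
rewrite [X in _ + X](_ : _ = 0) ?addr0 //.
(* A row below r allows q steps along the diagonal, any other one q - 1. *)
have [ltir|leri] := ltnP (m.-1 - i)%N r.
  by apply: (@diagonal_exit q.-1.+1); rewrite ?mulSn; lia.
by apply: (@diagonal_exit q.-1); lia.
Qed.

Hypothesis mirror_scalar : forall i j, (i < m)%N -> (j < m)%N ->
  mirror i j = if i == j then mirror 0 0 else 0.

Let block_scalar i j : (i < m)%N -> (j < m)%N ->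
  X i j = if i == j then X 0 0 else 0.
Proof.
have XE a b : (a < m)%N -> (b < m)%N -> X a b = mirror (m.-1 - a)%N (m.-1 - b)%N.
  by move=> lta ltb; rewrite /mirror; congr X; lia.
move=> lti ltj; rewrite XE // (XE 0%N 0%N) // mirror_scalar; try lia.
rewrite [in RHS]mirror_scalar ?eqxx; try lia.
by have ->: (m.-1 - i == m.-1 - j)%N = (i == j) by lia.
Qed.

(** For m <= j < 2 m the equation in the place (i, j - m) gives X i j as an entry
of the commutator of a scalar block; for j >= 2 m the diagonal leaves through
the columns. *)
Let off_block i j : (i < m)%N -> (m <= j < n)%N -> X i j = 0.
Proof.
move=> lti /andP[lej ltj]; have [lt2|le2] := ltnP (j - m)%N m; last first.
  by apply: (@diagonal_exit q.-1); lia.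
have := XC (i := i) (j := (j - m)%N).
rewrite (sum_in (X^~ (j - m)%N)) // (sum_out (X i)) // subnK // ltj => /(_ _ _ _)/esym XE.
have {XE}/eqP := XE ltac:(lia) ltac:(lia) ltac:(lia).
have sum_eq (P : pred nat) F b c : (b < m)%N ->
    (forall k, (k < m)%N -> F (m.-1 - k)%N = if k == b then c else 0) ->
    \sum_(k < m | P k) F (m.-1 - k)%N = if P b then c else 0.
  move=> ltb FE; rewrite big_mkcond (bigD1 (Ordinal ltb)) //= FE // eqxx.
  by rewrite big1 ?addr0 // => k; rewrite FE // -val_eqE => /negPf/= ->; rewrite if_same.
set j' := (m.-1 - (j - m))%N.
rewrite (sum_eq (G' j') (X i) (m.-1 - i)%N (X 0 0)); try lia; last first.
  move=> k ltk; rewrite block_scalar //; try lia.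
  by congr (if _ then _ else _); lia.
rewrite (sum_eq (G'^~ (m.-1 - i)%N) (X^~ (j - m)%N) j' (X 0 0));
  try lia; last first.
  move=> k ltk; rewrite block_scalar //; try lia.
  by congr (if _ then _ else _); lia.
by rewrite eq_sym -subr_eq0 opprD addrA subrr sub0r oppr_eq0 => /eqP.
Qed.

Lemma scalar_step i j : (i < n)%N -> (j < n)%N ->
  X i j = if i == j then X 0 0 else 0.
Proof.
elim/ltn_ind: i j => i IHi j lti ltj.
have [ltim|leim] := ltnP i m; have [ltjm|lejm] := ltnP j m.
- exact: block_scalar.
- by rewrite off_block ?lejm // ifN //; lia.
- by rewrite X0 // ifN //; lia.
have := @diagonal_step (i - m)%N (j - m)%N; rewrite !subnK // ltj lti => <-; try lia.
by rewrite IHi; try lia; congr (if _ then _ else _); lia.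
Qed.

End Step.

(** The induction passes from (n, m) to (m, comodulus n m) and ends at n = 1,
where every matrix is scalar. *)
Lemma euclidean_graph_rigid n m G X :
  euclidean_graph n m G -> block_triangular n m X -> block_commutes n m G X ->
  forall i j, (i < n)%N -> (j < n)%N -> X i j = if i == j then X 0 0 else 0.
Proof.
move=> eg; elim: eg X => {n m G} [m G|n m G G' /andP[m_gt0 ltmn] _ IH GE] X X0 XC.
  by case=> // [] [].
apply: (scalar_step m_gt0 ltmn GE X0 XC); apply: IH.
  exact: mirror_triangular m_gt0 ltmn GE X0 XC.
exact: mirror_commutes m_gt0 ltmn GE X0 XC.
Qed.

End Rigidity.

(** * The radical of the cyclic functional *)

Section Functional.
Local Open Scope ring_scope.
Variables (K : fieldType) (n m : nat).
Let arrow a b := (a, b) \in graph_arrows 1 (cyclic_order n m).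
Let F := cyclic_functional K n m.

(** This is the entry (i, j) of [A, X], as tr (A [X, Y]) = tr ([A, X] Y). *)
Lemma cyclic_functional_lie_delta (X : 'M[K]_n) (i j : 'I_n) :
  F (lie X (delta_mx j i))
  = \sum_(k < n | arrow k i) X k j - \sum_(k < n | arrow j k) X i k.
Proof.
have FE (Y : 'M_n) : F Y = \sum_(a < n) \sum_(b < n | arrow a b) Y a b.
  rewrite /F /cyclic_functional entry_functionalE pair_big_dep /=.
  by apply: eq_bigl => p; rewrite inE.
have right_delta a b : (X *m delta_mx j i) a b = if b == i then X a j else 0.
  rewrite !mxE (bigD1 j) //= !mxE eqxx big1 ?addr0 => [|k /negPf neq].
    by case: eqP; rewrite ?mulr1 ?mulr0.
  by rewrite mxE neq mulr0.
have left_delta a b : (delta_mx j i *m X) a b = if a == j then X i b else 0.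
  rewrite !mxE (bigD1 i) //= !mxE eqxx andbT big1 ?addr0 => [|k /negPf neq].
    by case: eqP; rewrite ?mul1r ?mul0r.
  by rewrite mxE neq andbF mul0r.
rewrite linearB /= !FE; congr (_ - _).
  rewrite (exchange_big_dep predT) //= (bigD1 i) //=.
  rewrite [X in _ + X]big1 ?addr0 => [|b /negPf neq].
    by apply: eq_bigr => k _; rewrite right_delta eqxx.
  by apply: big1 => k _; rewrite right_delta neq.
rewrite (bigD1 j) //= [X in _ + X]big1 ?addr0 => [|a /negPf neq].
  by apply: eq_bigr => k _; rewrite left_delta eqxx.
by apply: big1 => k _; rewrite left_delta neq.
Qed.

Lemma cyclic_functional_euclidean :
  (0 < m < n)%N -> coprime n m -> euclidean_graph n m arrow.
Proof.
move=> bd co; have [_] := euclidean_graph_arrows 1 0 0 bd co.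
by rewrite rot0 /place /= map_id.
Qed.

End Functional.

Section Annihilator.
Local Open Scope ring_scope.
Variables (K : fieldType) (n m : nat).
Local Notation F := (cyclic_functional K n m).

(** An off-diagonal delta_mx j i outside the zero block is in the parabolic
subalgebra.  A diagonal one has trace 1, but the difference of two of them is
in the subalgebra, so F takes the same value on all n brackets; these add up to
F ([X, 1]) = 0 and n is invertible. *)
Lemma orthogonal_lie_delta (X : 'M[K]_n) :
  (n%:R != 0 :> K) ->
  (forall Y, Y \in parabolic K n m -> F (lie X Y) = 0) ->
  forall i j : 'I_n, ~~ (i < m <= j)%N -> F (lie X (delta_mx j i)) = 0.
Proof.
move=> n_neq0 FX0 i j nij.
have tr_delta (a b : 'I_n) : \tr (delta_mx a b : 'M[K]_n) = (a == b)%:R.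
  rewrite /mxtrace (bigD1 a) //= mxE eqxx big1 ?addr0 // => k /negPf neq.
  by rewrite mxE neq.
have [<-{j nij}|neq_ij] := eqVneq i j; last first.
  apply: FX0; apply/parabolicP; split.
    by rewrite tr_delta eq_sym (negPf neq_ij).
  move=> a b lea ltb; rewrite mxE; case: eqP => //= Da; case: eqP => //= Db.
  by rewrite -Da -Db ltb lea in nij.
have diag k : F (lie X (delta_mx k k)) = F (lie X (delta_mx i i)).
  apply/eqP; rewrite -subr_eq0 -linearB /=.
  have ->: lie X (delta_mx k k) - lie X (delta_mx i i)
         = lie X (delta_mx k k - delta_mx i i).
    by rewrite addrC -scaleN1r -lie_linearr scaleN1r addrC.
  apply/eqP/FX0/parabolicP; split; first by rewrite linearB /= !tr_delta !eqxx subrr.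
  move=> a b lea ltb; have neq_ab : a != b.
    by apply: contraTneq ltb => <-; rewrite -leqNgt.
  have off (c : 'I_n) : (a == c) && (b == c) = false.
    by apply: contraNF neq_ab => /andP[/eqP-> /eqP->].
  by rewrite !mxE !off subrr.
have: \sum_k F (lie X (delta_mx k k)) = 0.
  have F_linear : F (\sum_k lie X (delta_mx k k))
                  = \sum_k F (lie X (delta_mx k k)) by exact: linear_sum.
  rewrite -F_linear sumrB -mulmx_sumr -mulmx_suml.
  have ->: \sum_k delta_mx k k = 1%:M :> 'M[K]_n by rewrite -mx1_sum_delta.
  by rewrite mulmx1 mul1mx subrr linear0.
rewrite (eq_bigr _ (fun k _ => diag k)) sumr_const card_ord => /eqP.
by rewrite -mulr_natl mulf_eq0 (negPf n_neq0) => /eqP.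
Qed.

End Annihilator.

Theorem theorem6 (K : fieldType) (n m : nat) :
  [pchar K]%R =i pred0 ->
  2 <= n -> 1 <= m <= n.-1 -> gcdn n m = 1 ->
  frobenius_functional (parabolic K n m) (cyclic_functional K n m).
Proof.
move=> charK gtn1 /andP[m_gt0 lemn] /eqP co_nm.
have bd : 0 < m < n by lia.
have n_neq0 : (n%:R != 0 :> K)%R by rewrite ((pcharf0P K).1 charK); lia.
apply/frobenius_functionalP => X /parabolicP[trX X0] FX0.
case: n => [//|n] in X trX X0 FX0 gtn1 lemn bd co_nm n_neq0 *.
pose x a b := X (inord a) (inord b).
have x_scalar : forall i j, i < n.+1 -> j < n.+1 ->
    x i j = (if i == j then x 0 0 else 0)%R.
  apply: (euclidean_graph_rigid (cyclic_functional_euclidean bd co_nm)) => i j lti ltj.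
    by move=> lei ltjm; apply: X0; rewrite inordK.
  move=> nij; apply/eqP; rewrite -GRing.subr_eq0 /x; apply/eqP.
  have := orthogonal_lie_delta n_neq0 FX0 (i := inord i) (j := inord j).
  rewrite cyclic_functional_lie_delta !inordK // => /(_ nij) XC.
  rewrite -[RHS]XC; congr (_ - _)%R; apply: eq_bigr => k _;
    by rewrite inord_val.
have XE (i j : 'I_n.+1) : X i j = (if i == j :> nat then x 0 0 else 0)%R.
  by rewrite -(x_scalar i j) // /x !inord_val.
have x00 : x 0 0 = 0%R.
  have /eqP := trX; have -> : (\tr X = n.+1%:R * x 0 0)%R.
    rewrite mulr_natl -[X in (_ *+ X)%R](card_ord n.+1) -sumr_const.
    by apply: eq_bigr => i _; rewrite XE eqxx.
  by rewrite mulf_eq0 (negPf n_neq0) => /eqP.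
by apply/matrixP => i j; rewrite XE x00 mxE if_same.
Qed.
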